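(* For $2\le k\le n$ we have \begin{enumerate} \item[(i)] $\mathrm{ex}(n,\mathit{Sf}_4(1,k))\approx k^2n^2$, \item[(ii)] $\mathrm{ex}(n,\mathit{Sf}_4(2,k))\approx k^2n^2$, and \item[(iii)] $\mathrm{ex}(n,\mathit{Sf}_4(3,k))\approx kn^3$. \end{enumerate}
   Context: For an $r$-graph ($r$-uniform hypergraph) $\mathcal{F}$, the Turán number $\mathrm{ex}(n,\mathcal{F})$ is the maximum number of edges of an $r$-graph on $n$ vertices containing no copy of $\mathcal{F}$. A sunflower is a family of distinct sets $A_1,\dots,A_k$ such that there is a kernel $C$ contained in each $A_i$ with the petals $A_i\setminus C$ pairwise disjoint. $\mathit{Sf}_r(t,k)$ denotes the $r$-uniform sunflower with $k$ petals and kernel of size $t$ (i.e. $k$ $r$-sets pairwise intersecting exactly in a common $t$-set). $f\approx g$ means there are absolute constants $c,C>0$ with $cg\le f\le Cg$ for all $n$ and $k$ in the stated range.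
   Formalization: The range 2 ≤ k ≤ n is restricted to n ≥ 4, since for n = 2, 3 there are no 4-element vertex sets, so every Turán number is 0 and the lower bounds fail for any positive constant. *)

(* Defs.v *)
From mathcomp Require Import all_boot all_order all_algebra.
From mathcomp Require Import reals.

Set Implicit Arguments.
Unset Strict Implicit.
Unset Printing Implicit Defensive.

Import Order.TTheory GRing.Theory Num.Theory.

(* A hypergraph on the vertex set V is identified with its edge set, of type  *)
(* {set {set V}}.                                                             *)

Definition uniform (V : finType) (r : nat) (H : {set {set V}}) : bool :=
  [forall e in H, #|e| == r].

(* A copy is a not necessarily induced subhypergraph. *)
Definition contains_copy (W V : finType) (F : {set {set W}})
    (H : {set {set V}}) : bool :=
  [exists f : {ffun W -> V}, injectiveb f && [forall e in F, f @: e \in H]].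

Definition ex (W : finType) (r n : nat) (F : {set {set W}}) : nat :=
  \max_(H : {set {set 'I_n}} | uniform r H && ~~ contains_copy F H) #|H|.

Definition is_sunflower (V : finType) (k : nat) (A : 'I_k -> {set V})
    (C : {set V}) : Prop :=
  [/\ injective A,
      forall i, C \subset A i
    & forall i j, i != j -> [disjoint A i :\: C & A j :\: C]].

(* The vertices inl x form the kernel; the vertices inr (i, j), j < r - t,    *)
(* form the i-th petal. This is the intended hypergraph only when t < r (for  *)
(* t >= r all the edges coincide); see Sf_uniform and contains_SfP.           *)
Definition Sf_edge (r t k : nat) (i : 'I_k) :
    {set 'I_t + 'I_k * 'I_(r - t)} :=
  [set inl x | x : 'I_t] :|: [set inr (i, j) | j : 'I_(r - t)].

Definition Sf (r t k : nat) : {set {set 'I_t + 'I_k * 'I_(r - t)}} :=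
  [set Sf_edge r t i | i : 'I_k].

Definition approx_on (R : realType) (P : nat -> nat -> bool)
    (f g : nat -> nat -> nat) : Prop :=
  exists c C : R,
    [/\ (0 < c)%R, (0 < C)%R
      & forall n k, P n k ->
          (c * (g n k)%:R <= (f n k)%:R)%R /\ ((f n k)%:R <= C * (g n k)%:R)%R].

Lemma card_Sf_edge r t k (i : 'I_k) : t <= r -> #|Sf_edge r t i| = r.
Proof.
move=> le_tr; rewrite cardsU.
rewrite [_ :&: _](_ : _ = set0) ?cards0 ?subn0; last first.
  apply/setP=> x; rewrite !inE; apply/negP=> /andP[/imsetP[y _ ->]].
  by case/imsetP.
rewrite !card_imset ?card_ord ?subnKC //; first by move=> x y [].
by move=> x y [].
Qed.

Lemma Sf_uniform r t k : t <= r -> uniform r (Sf r t k).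
Proof.
by move=> le_tr; apply/forall_inP=> e /imsetP[i _ ->]; rewrite card_Sf_edge.
Qed.

Lemma Sf_edge_sunflower r t k : t < r ->
  is_sunflower (@Sf_edge r t k) [set inl x | x : 'I_t].
Proof.
move=> lt_tr.
have mem_petal (i : 'I_k) x :
    x \in Sf_edge r t i :\: [set inl x | x : 'I_t] -> exists j, x = inr (i, j).
  by rewrite !inE; case/andP=> /negPf-> /= /imsetP[j _ ->]; exists j.
split=> [i i' eq_e|i|i i' ne_ii'].
- have j : 'I_(r - t) by apply: (@Ordinal _ 0); rewrite subn_gt0.
  have: inr (i, j) \in Sf_edge r t i'.
    by rewrite -eq_e !inE; apply/orP; right; apply/imsetP; exists j.
  by rewrite !inE => /orP[/imsetP[]|/imsetP[j' _ []]].
- exact: subsetUl.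
- rewrite -setI_eq0; apply/eqP/setP=> x; rewrite [RHS]inE in_setI.
  apply/negP=> /andP[/mem_petal[j ->] /mem_petal[j' [eq_ii' _]]].
  by rewrite eq_ii' eqxx in ne_ii'.
Qed.

Lemma contains_SfP (V : finType) (r t k : nat) (H : {set {set V}}) :
  t < r -> uniform r H ->
  reflect
    (exists (A : 'I_k -> {set V}) (C : {set V}),
       [/\ is_sunflower A C, #|C| = t & forall i, A i \in H])
    (contains_copy (Sf r t k) H).
Proof.
move=> lt_tr /forall_inP Hr; apply: (iffP existsP).
  case=> f /andP[/injectiveP f_inj /forall_inP fH].
  have [e_inj subCe dis_e] := Sf_edge_sunflower k lt_tr.
  exists (fun i => f @: Sf_edge r t i), (f @: [set inl x | x : 'I_t]).
  split; last by move=> i; apply: fH; apply: imset_f.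
    split=> [i i' /(imset_inj f_inj)/e_inj //|i|i i' /dis_e].
      exact: imsetS.
    have DI (X Y : {set _}) : f @: (X :\: Y) = (f @: X) :\: (f @: Y).
      apply/setP=> y; rewrite inE; apply/imsetP/andP.
        case=> x; rewrite inE => /andP[xY xX] ->.
        by rewrite !mem_imset.
      case=> yY /imsetP[x xX eq_y]; exists x => //.
      by rewrite inE xX andbT -(mem_imset _ _ f_inj) -eq_y.
    by rewrite -!DI imset_disjoint //; move=> ? ? _ _; apply: f_inj.
  by rewrite !card_imset ?card_ord // => x y [].
case=> A [C [[A_inj subCA dis_A] cardC AH]].
have cardA i : #|A i :\: C| = r - t.
  by rewrite cardsD (setIidPr (subCA i)) cardC (eqP (Hr _ (AH i))).
pose f0 (x : 'I_t + 'I_k * 'I_(r - t)) : V := match x with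
  | inl x => enum_val (cast_ord (esym cardC) x)
  | inr ij => enum_val (cast_ord (esym (cardA ij.1)) ij.2)
  end.
have f0C x : f0 (inl x) \in C by exact: enum_valP.
have f0A i j : f0 (inr (i, j)) \in A i :\: C.
  exact: (enum_valP (cast_ord (esym (cardA i)) j)).
have f0_inj : injective f0.
  move=> [x|[i j]] [y|[i' j']] eq_f.
  - by congr inl; move/enum_val_inj: eq_f => /cast_ord_inj.
  - by have := f0A i' j'; rewrite -eq_f inE f0C.
  - by have := f0A i j; rewrite eq_f inE f0C.
  have [eq_ii'|ne_ii'] := eqVneq i i'.
    by subst i'; move/enum_val_inj: eq_f => /cast_ord_inj /= ->.
  by have := disjointFr (dis_A _ _ ne_ii') (f0A i j); rewrite eq_f f0A.
exists (finfun f0); apply/andP; split.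
  by apply/injectiveP=> x y; rewrite !ffunE; apply: f0_inj.
apply/forall_inP=> e /imsetP[i _ ->].
suff ->: [ffun x => f0 x] @: Sf_edge r t i = A i by [].
apply/eqP; rewrite eqEcard card_imset; last first.
  by move=> x y; rewrite !ffunE; apply: f0_inj.
rewrite card_Sf_edge ?(ltnW lt_tr) // (eqP (Hr _ (AH i))) leqnn andbT.
apply/subsetP=> y /imsetP[x]; rewrite ffunE inE => /orP[] /imsetP[z _ ->] ->.
  exact: (subsetP (subCA i)) (f0C z).
by have := f0A i z; rewrite inE => /andP[].
Qed.

(* Main.v *)
Require Import Defs.
From mathcomp Require Import all_boot all_order all_algebra.
From mathcomp Require Import reals.
From mathcomp Require Import zify ring.

(* Upper bounds.  Let nu(C) be the largest number of petals of a sunflower of H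
   with kernel C, and U(C) the union of the petals of such a sunflower,
   so |U(C)| = O(nu(C)).  By maximality, U(C) meets e \ C for every edge e
   containing C, and contains every z such that nu(C + z) > 3 nu(C).  Call a
   pair rich if nu >= 3k and a triple rich if nu >= 9k.  The vertices of every
   edge can be ordered as x, y, z, w so that one of the following holds:
   - xy is not rich, and xyz, xyw are both rich or both not rich; then z and w
     are found in O(k) ways each, giving O(n^2 k^2) edges;
   - xy is rich and xyz is not: y is in U(x) and w in U(xyz), O(n^2 k^2) edges;
   - xy, xz and xw are rich: y, z, w are in U(x), O(n k^3) edges.
   If Sf(2,k) is forbidden there are no rich pairs; if Sf(1,k) is forbidden,
   nu(x) < k for every vertex x.

   Lower bounds.  All constructions are 4-partite with parts of size O(n), and
   with N of order n and s of order k: the edges are (a, b, c, d) with a, b < s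
   and c, d < N for t = 1; (a, b, a + b + i, a + 2b + j) for t = 2; and
   (a, b, c, a + b + c + i) for t = 3; where i, j < s and the other free
   coordinates are < N.  In each case any t coordinates confine some other
   coordinate to fewer than k values. *)

Set Implicit Arguments.
Unset Strict Implicit.
Unset Printing Implicit Defensive.

Import Order.TTheory GRing.Theory Num.Theory.

(** * Maximum sunflowers with a given kernel *)

Section MaximalSunflower.

Variables (V : finType) (H : {set {set V}}).
Hypothesis H4 : uniform 4 H.
Implicit Types (C U : {set V}) (M : {set {set V}}).

(** Sunflowers are sets of edges here, so that one of maximum size can be picked; [set0] qualifies
    for every [C]. *)
Definition sunflower_at C M : bool :=
  [&& M \subset H, [forall e in M, C \subset e]
    & [forall e in M, forall f in M, (e != f) ==> (e :&: f \subset C)]].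

Lemma sunflower_atP C M :
  reflect [/\ {subset M <= H}, forall e, e \in M -> C \subset e
            & forall e f, e \in M -> f \in M -> e != f -> e :&: f \subset C]
          (sunflower_at C M).
Proof.
apply: (iffP and3P) => [[/subsetP MH /forall_inP CM /forall_inP dM]|[MH CM dM]].
  split=> // e f eM fM; exact: implyP (forall_inP (dM e eM) f fM).
split; [exact/subsetP | exact/forall_inP |].
by apply/forall_inP=> e eM; apply/forall_inP=> f fM; apply/implyP; apply: dM.
Qed.

Definition max_sunflower C : {set {set V}} :=
  [arg max_(M > set0 | sunflower_at C M) #|M|].

Definition sunflower_number C : nat := #|max_sunflower C|.

Definition petals C : {set V} := \bigcup_(e in max_sunflower C) (e :\: C).

Lemma max_sunflowerP C :
  sunflower_at C (max_sunflower C)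
  /\ forall M, sunflower_at C M -> #|M| <= sunflower_number C.
Proof.
rewrite /sunflower_number /max_sunflower; case: arg_maxnP => //.
by apply/sunflower_atP; split=> e; rewrite ?inE // => f; rewrite inE.
Qed.

Lemma edge_card e : e \in H -> #|e| = 4.
Proof. by move=> eH; apply/eqP; apply: (forall_inP H4). Qed.

(** An edge has at most three vertices outside a nonempty kernel. *)
Lemma card_petals C : 0 < #|C| -> #|petals C| <= 3 * sunflower_number C.
Proof.
have [/sunflower_atP[MH CM _] _] := max_sunflowerP C => C_gt0.
rewrite mulnC /sunflower_number -sum_nat_const /petals.
apply: (@leq_trans (\sum_(e in max_sunflower C) #|e :\: C|)).
  elim/big_rec2: _ => [|e m U _ leUm]; first by rewrite cards0.
  by rewrite (leq_trans (leq_card_setU _ _)) ?leq_add2l.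
apply: leq_sum => e eM.
by rewrite cardsD (setIidPr (CM e eM)) (edge_card (MH e eM)); lia.
Qed.

(** Otherwise [e] could be added to the maximum sunflower. *)
Lemma edge_meets_petals C e : e \in H -> C \subset e -> #|C| < 4 ->
  exists2 u, u \in e :\: C & u \in petals C.
Proof.
move=> eH Ce C_lt4; have [/sunflower_atP[MH CM dM] maxM] := max_sunflowerP C.
have /card_gt0P[v v_eC] : 0 < #|e :\: C|.
  by rewrite cardsD (setIidPr Ce) (edge_card eH) subn_gt0.
have [/existsP[u /andP[]]|/existsPn no_u] :=
  boolP [exists u, (u \in e :\: C) && (u \in petals C)]; first by exists u.
(* As [C] is smaller than an edge, the petal of [e] is nonempty and would lie in [petals C]. *)
have e_notin : e \notin max_sunflower C.
  apply/negP=> eM; have := no_u v; rewrite v_eC /=.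
  by move/bigcupP; apply; exists e.
have dis f : f \in max_sunflower C -> e :&: f \subset C.
  move=> fM; apply/subsetP=> u; rewrite inE => /andP[ue uf].
  have := no_u u; rewrite inE ue andbT negb_and negbK => /orP[//|u_notin].
  apply: contraR u_notin => uC; apply/bigcupP; exists f => //.
  by rewrite inE uC uf.
have /maxM : sunflower_at C (e |: max_sunflower C).
  apply/sunflower_atP; split=> [f|f|f g].
  - by rewrite !inE => /predU1P[->|/MH].
  - by rewrite !inE => /predU1P[->|/CM].
  rewrite !inE => /predU1P[->|fM] /predU1P[->|gM] ne_fg; last exact: dM.
  - by rewrite eqxx in ne_fg.
  - exact: dis.
  - by rewrite setIC dis.
by rewrite cardsU1 e_notin /sunflower_number add1n ltnn.
Qed.

(* If [z] were outside [petals C], the edges of a maximal sunflower with kernel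
   [C + z] would meet [petals C] in distinct points, so there would be at most
   [#|petals C|] of them. *)
Lemma rich_extension_in_petals C z : 0 < #|C| < 4 -> z \notin C ->
  3 * sunflower_number C < sunflower_number (C :|: [set z]) -> z \in petals C.
Proof.
case/andP=> C_gt0 C_lt4 zC; set D := C :|: [set z]; apply: contraLR => zU.
have [/sunflower_atP[NH DN dN] _] := max_sunflowerP D.
rewrite -leqNgt (leq_trans _ (card_petals C_gt0)) //.
have hit e : e \in max_sunflower D -> exists u, (u \in e :\: C) && (u \in petals C).
  move=> eN; have [||u ue uU] := @edge_meets_petals C e (NH e eN) => //.
    exact: subset_trans (subsetUl _ _) (DN e eN).
  by exists u; rewrite ue.
(* By [hit], the default [z] is never taken on edges of the sunflower. *)
pose g e := odflt z [pick u | (u \in e :\: C) && (u \in petals C)].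
have gP e : e \in max_sunflower D -> [/\ g e \in e, g e \in petals C & g e \notin D].
  move=> /hit[u u_eU]; rewrite /g; case: pickP => [v /= /andP[v_eC vU]|/(_ u)].
    move: v_eC; rewrite !inE => /andP[/negPf-> ->]; split=> //=.
    by apply: contraNneq zU => <-.
  by rewrite u_eU.
rewrite /sunflower_number -(card_in_imset (f := g)).
  by apply/subset_leq_card/subsetP=> _ /imsetP[e /gP[_ ? _] ->].
(* Two edges with the same image would share a vertex outside their kernel [D]. *)
move=> e f eN fN eq_g; apply/eqP/negPn/negP=> ne_ef.
have [ge _ /negP gD] := gP e eN; have [gf _ _] := gP f fN; apply: gD.
by apply: (subsetP (dN e f eN fN ne_ef)); rewrite inE ge eq_g.
Qed.

(** Any [k] edges of a sunflower with kernel [C] form a copy of [Sf 4 t k]. *)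
Lemma sunflower_number_lt t k C : t < 4 -> #|C| = t ->
  ~~ contains_copy (Sf 4 t k) H -> sunflower_number C < k.
Proof.
move=> t_lt4 cardC; rewrite ltnNge; apply: contra => k_le.
have [/sunflower_atP[MH CM dM] _] := max_sunflowerP C.
apply/(contains_SfP _ t_lt4 H4).
pose A (i : 'I_k) : {set V} := enum_val (widen_ord k_le i).
have A_inj : injective A by move=> i j /enum_val_inj[/val_inj].
have AM i : A i \in max_sunflower C by exact: enum_valP.
exists A, C; split=> // [|i]; last exact: MH.
split=> // [i|i j ne_ij]; first exact: CM.
rewrite -setI_eq0 -subset0; apply/subsetP=> u; rewrite !inE.
case/andP=> /andP[uC uAi] /andP[_ uAj].
rewrite -(negPf uC); apply: (subsetP (dM (A i) (A j) _ _ _)); rewrite ?AM //.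
  by rewrite (inj_eq A_inj).
by rewrite inE uAi.
Qed.

(** Emptied when the sunflower number is large, so that [3 * b] bounds its size for every nonempty
    [C]. *)
Definition small_petals b C : {set V} :=
  if sunflower_number C < b then petals C else set0.

Lemma card_small_petals b C : 0 < #|C| -> #|small_petals b C| <= 3 * b.
Proof.
rewrite /small_petals => C_gt0; case: ifP => [lt_b|_]; last by rewrite cards0.
by rewrite (leq_trans (card_petals C_gt0)) // leq_mul2l ltnW.
Qed.

End MaximalSunflower.

(** * Counting quadruples by successive choices *)

Definition extend (V T : finType) (P : {set T}) (F : T -> {set V}) :
    {set T * V} :=
  [set p | (p.1 \in P) && (p.2 \in F p.1)].

Lemma card_extend (V T : finType) (P : {set T}) (F : T -> {set V}) b :
  (forall p, #|F p| <= b) -> #|extend P F| <= #|P| * b.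
Proof.
move=> leFb; rewrite -sum1_card.
under eq_bigl => p do rewrite inE.
rewrite -(pair_big_dep (mem P) (fun p z => z \in F p) (fun _ _ => 1)) /=.
by rewrite -sum_nat_const; apply: leq_sum => p _; rewrite sum1_card.
Qed.

Lemma in_extend (V T : finType) (P : {set T}) (F : T -> {set V}) p z :
  ((p, z) \in extend P F) = (p \in P) && (z \in F p).
Proof. by rewrite inE. Qed.

Definition quad_set (V : finType) (q : V * V * V * V) : {set V} :=
  [set q.1.1.1; q.1.1.2; q.1.2; q.2].

Section Quadruples.

Variables (V : finType) (U : {set V} -> {set V}).

(** The four families serve these cases in turn: [xy] not rich with both its triples not rich; [xy]
    not rich with both rich; [xy] rich and [xyz] not; all pairs at [x] rich. The first three leave
    two vertices free, the last only [x]. *)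
Definition quads_light_pair : {set V * V * V * V} :=
  extend (extend setT (fun p : V * V => U [set p.1; p.2]))
    (fun p : V * V * V => U [set p.1.1; p.1.2; p.2]).

Definition quads_rich_triples : {set V * V * V * V} :=
  extend (extend setT (fun p : V * V => U [set p.1; p.2]))
    (fun p : V * V * V => U [set p.1.1; p.1.2]).

Definition quads_rich_pair : {set V * V * V * V} :=
  extend (extend (extend setT (fun x : V => U [set x])) (fun=> setT))
    (fun p : V * V * V => U [set p.1.1; p.1.2; p.2]).

Definition quads_rich_star : {set V * V * V * V} :=
  extend (extend (extend setT (fun x : V => U [set x]))
    (fun p : V * V => U [set p.1])) (fun p : V * V * V => U [set p.1.1]).

Definition quads : {set V * V * V * V} :=
  quads_light_pair :|: quads_rich_triples :|: quads_rich_pair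
  :|: quads_rich_star.

Lemma in_quads x y z w :
  ((x, y, z, w) \in quads) =
  [|| (z \in U [set x; y]) && (w \in U [set x; y; z]),
      (z \in U [set x; y]) && (w \in U [set x; y]),
      (y \in U [set x]) && (w \in U [set x; y; z])
    | [&& y \in U [set x], z \in U [set x] & w \in U [set x]]].
Proof. by rewrite !in_setU !in_extend /= !in_setT /= andbT -!orbA -andbA. Qed.

Lemma card_quads b : (forall C : {set V}, 0 < #|C| -> #|U C| <= b) ->
  #|quads| <= 3 * (#|V| ^ 2 * b ^ 2) + #|V| * b ^ 3.
Proof.
move=> leUb; have U0 (x : V) (A : {set V}) : x \in A -> #|U A| <= b.
  by move=> xA; apply: leUb; apply/card_gt0P; exists x.
have U1 (x : V) : #|U [set x]| <= b by apply: (U0 x); rewrite set11.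
have U2 (x y : V) : #|U [set x; y]| <= b by apply: (U0 x); rewrite !inE eqxx.
have U3 (x y z : V) : #|U [set x; y; z]| <= b.
  by apply: (U0 x); rewrite !inE eqxx.
have cardT : #|[set: V]| = #|V| by rewrite cardsT.
have cardVV : #|[set: V * V]| = #|V| * #|V| by rewrite cardsT card_prod.
have leT (p : V * V) : #|[set: V]| <= #|V| by rewrite cardsT.
have le1 : #|quads_light_pair| <= #|V| * #|V| * b * b.
  apply: leq_trans (card_extend _ (fun p => U3 p.1.1 p.1.2 p.2)) _.
  by rewrite leq_mul2r -cardVV card_extend ?orbT.
have le2 : #|quads_rich_triples| <= #|V| * #|V| * b * b.
  apply: leq_trans (card_extend _ (fun p => U2 p.1.1 p.1.2)) _.
  by rewrite leq_mul2r -cardVV card_extend ?orbT.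
have le3 : #|quads_rich_pair| <= #|V| * b * #|V| * b.
  apply: leq_trans (card_extend _ (fun p => U3 p.1.1 p.1.2 p.2)) _.
  rewrite leq_mul2r; apply/orP; right.
  apply: leq_trans (card_extend _ leT) _.
  by rewrite leq_mul2r -[X in X * b]cardT card_extend ?orbT.
have le4 : #|quads_rich_star| <= #|V| * b * b * b.
  apply: leq_trans (card_extend _ (fun p => U1 p.1.1)) _.
  rewrite leq_mul2r; apply/orP; right.
  apply: leq_trans (card_extend _ (fun p => U1 p.1)) _.
  by rewrite leq_mul2r -[X in X * b]cardT card_extend ?orbT.
rewrite /quads !cardsU.
have -> : 3 * (#|V| ^ 2 * b ^ 2) + #|V| * b ^ 3 =
    #|V| * #|V| * b * b + #|V| * #|V| * b * b + #|V| * b * #|V| * b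
      + #|V| * b * b * b by ring.
lia.
Qed.

End Quadruples.

(** * Orderings of the four vertices of an edge *)

Lemma card4P (V : finType) (e : {set V}) : #|e| = 4 ->
  exists x y z w,
    e = [set x; y; z; w] /\
    [&& x != y, x != z, x != w, y != z, y != w & z != w].
Proof.
rewrite cardE => size_e; have := enum_uniq e; have := mem_enum e.
case: (enum e) size_e => [|x [|y [|z [|w []]]]] // _ mem_e.
rewrite /= !inE !negb_or andbT => /and3P[/and3P[xy xz xw] /andP[yz yw] zw].
exists x, y, z, w; split; last by rewrite xy xz xw yz yw.
by apply/setP=> u; rewrite -mem_e !inE !orbA.
Qed.

(* [p], [q], [r] tell whether the pairs xy, xz, xw are rich, and [t], [u]
   whether the triples xyz, xyw are. *)
Definition good_order (p q r t u : bool) : bool :=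
  [|| ~~ p && (t == u), p && ~~ (t && u) | [&& p, q & r]].

(** If two triples are not rich, their common pair starts a good order. Otherwise three rich triples
    share a vertex, and each of its three pairs lies in two of them: either one of these pairs is
    not rich, or all three are. Six orders provide every first pair; the seventh lets the fourth
    vertex come first. *)
Lemma good_order_exists p12 p13 p14 p23 p24 p34 t123 t124 t134 t234 :
  [|| good_order p12 p13 p14 t123 t124, good_order p13 p12 p14 t123 t134,
      good_order p14 p12 p13 t124 t134, good_order p23 p12 p24 t123 t234,
      good_order p24 p12 p23 t124 t234, good_order p34 p13 p23 t134 t234
    | good_order p34 p14 p24 t134 t234].
Proof.
by case: p12; case: p13; case: p14; case: p23; case: p24; case: p34;
   case: t123; case: t124; case: t134; case: t234.
Qed.

(** * Upper bounds *)

Section UpperBound.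

Variables (V : finType) (H : {set {set V}}) (k : nat).
Hypothesis H4 : uniform 4 H.

(** Thresholds [k], [3 * k], [9 * k] for vertices, pairs and triples grow by the factor 3 of
    [rich_extension_in_petals]: below its threshold, a kernel has in its petals every vertex that
    extends it to a rich set. *)
Let rich2 x y := 3 * k <= sunflower_number H [set x; y].
Let rich3 x y z := 9 * k <= sunflower_number H [set x; y; z].
Let U := small_petals H (9 * k).

Let in_U C z : sunflower_number H C < 9 * k -> z \in petals H C -> z \in U C.
Proof. by rewrite /U /small_petals => ->. Qed.

Let card3 (x y z : V) : x != y -> x != z -> y != z -> #|[set x; y; z]| = 3.
Proof.
move=> xy xz yz.
by rewrite setUC cardsU1 cards2 xy !inE negb_or ![z == _]eq_sym xz yz.
Qed.

(** The petals meet the edge outside the triple, where [w] is the only vertex. *)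
Lemma light_triple x y z w : x != y -> x != z -> y != z ->
  [set x; y; z; w] \in H -> ~~ rich3 x y z -> w \in U [set x; y; z].
Proof.
move=> xy xz yz eH; rewrite /rich3 -ltnNge => lt3; apply: in_U => //.
have [|u u_e] := edge_meets_petals H4 eH (subsetUl _ _); first by rewrite card3.
by move: u_e; rewrite !in_setD !in_setU !in_set1; case/andP=> /negPf-> /= /eqP->.
Qed.

Lemma rich_triple_light_pair x y z : x != y -> x != z -> y != z ->
  ~~ rich2 x y -> rich3 x y z -> z \in U [set x; y].
Proof.
move=> xy xz yz; rewrite /rich2 /rich3 -ltnNge => lt2 le3.
apply: in_U; first by lia.
apply: (rich_extension_in_petals H4); first by rewrite cards2 xy.
  by rewrite !inE ![z == _]eq_sym (negPf xz) (negPf yz).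
by apply: leq_trans le3; lia.
Qed.

(** What both forbidden sunflowers provide: for kernel size 1 every vertex satisfies the bound, for
    kernel size 2 no pair is rich. *)
Hypothesis light_vertex :
  forall x y, x != y -> rich2 x y -> sunflower_number H [set x] < k.

Lemma rich_pair_light_vertex x y : x != y -> rich2 x y -> y \in U [set x].
Proof.
move=> xy rich_xy; have lt1 := light_vertex xy rich_xy.
apply: in_U; first by lia.
apply: (rich_extension_in_petals H4); first by rewrite cards1.
  by rewrite inE eq_sym.
by apply: leq_trans rich_xy; lia.
Qed.

Lemma good_order_quad x y z w :
  [&& x != y, x != z, x != w, y != z, y != w & z != w] ->
  [set x; y; z; w] \in H ->
  good_order (rich2 x y) (rich2 x z) (rich2 x w) (rich3 x y z) (rich3 x y w) ->
  [set x; y; z; w] \in [set quad_set q | q in quads U].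
Proof.
case/and5P=> xy xz xw yz /andP[yw zw] eH.
have e_swap : [set x; y; z; w] = [set x; y; w; z].
  by rewrite -!setUA [[set z] :|: _]setUC.
have eH' : [set x; y; w; z] \in H by rewrite -e_swap.
have inQ : (x, y, z, w) \in quads U ->
    [set x; y; z; w] \in [set quad_set q | q in quads U].
  by move=> q_in; apply/imsetP; exists (x, y, z, w).
have inQ' : (x, y, w, z) \in quads U ->
    [set x; y; z; w] \in [set quad_set q | q in quads U].
  by move=> q_in; apply/imsetP; exists (x, y, w, z); rewrite ?e_swap.
rewrite !in_quads in inQ inQ'.
case/or3P.
- case/andP=> light /eqP eq_rich.
  have [rich_w|light_w] := boolP (rich3 x y w).
    rewrite rich_w in eq_rich.
    have zU := rich_triple_light_pair xy xz yz light eq_rich.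
    have wU := rich_triple_light_pair xy xw yw light rich_w.
    by apply: inQ; rewrite zU wU !orbT.
  rewrite (negPf light_w) in eq_rich; move/negbT: eq_rich => light_z.
  have lt2 : sunflower_number H [set x; y] < 9 * k.
    by apply: (@leq_trans (3 * k)); rewrite ?ltnNge // leq_mul2r orbT.
  have sub_e : [set x; y] \subset [set x; y; z; w] by rewrite -setUA subsetUl.
  have [|u u_e uP] := edge_meets_petals H4 eH sub_e; first by rewrite cards2 xy.
  have uU := in_U lt2 uP.
  have wU := light_triple xy xz yz eH light_z.
  have zU := light_triple xy xw yw eH' light_w.
  (* Whichever of [z], [w] lies in the petals of [xy], the other lies in those of the triple
     completed by it; [inQ'] covers the case with [z] and [w] swapped. *)
  have : (u == z) || (u == w).
    by move: u_e; rewrite !inE => /andP[/negPf->].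
  case/orP=> /eqP def_u; rewrite def_u in uU.
    by apply: inQ; rewrite uU wU.
  by apply: inQ'; rewrite uU zU.
(* The triple that is not rich confines the fourth vertex; its own third vertex stays free. *)
- rewrite negb_and => /andP[rich] light.
  have yU := rich_pair_light_vertex xy rich.
  case/orP: light => light.
    have wU := light_triple xy xz yz eH light.
    by apply: inQ; rewrite yU wU !orbT.
  have zU := light_triple xy xw yw eH' light.
  by apply: inQ'; rewrite yU zU !orbT.
case/and3P=> /(rich_pair_light_vertex xy) yU /(rich_pair_light_vertex xz) zU.
move/(rich_pair_light_vertex xw) => wU.
by apply: inQ; rewrite yU zU wU !orbT.
Qed.

Lemma edges_sub_quads : H \subset [set quad_set q | q in quads U].
Proof.
apply/subsetP=> e eH; have [x [y [z [w [def_e]]]]] := card4P (edge_card H4 eH).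
case/and5P=> xy xz xw yz /andP[yw zw].
have r2C a b : rich2 a b = rich2 b a by rewrite /rich2 setUC.
have r3C a b c : rich3 a b c = rich3 b a c by rewrite /rich3 [[set a; b]]setUC.
have r3R a b c : rich3 a b c = rich3 a c b.
  by rewrite /rich3 -!setUA [[set b] :|: _]setUC.
have perm a b c d : e = [set a; b; c; d] ->
    [&& a != b, a != c, a != d, b != c, b != d & c != d] ->
    good_order (rich2 a b) (rich2 a c) (rich2 a d) (rich3 a b c) (rich3 a b d) ->
    e \in [set quad_set q | q in quads U].
  move=> def_e' ne; rewrite [in X in _ -> X]def_e'.
  by apply: good_order_quad; rewrite -?def_e'.
have := good_order_exists (rich2 x y) (rich2 x z) (rich2 x w) (rich2 y z)
  (rich2 y w) (rich2 z w) (rich3 x y z) (rich3 x y w) (rich3 x z w)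
  (rich3 y z w).
have yx : y != x by rewrite eq_sym.
have zx : z != x by rewrite eq_sym.
have wx : w != x by rewrite eq_sym.
have zy : z != y by rewrite eq_sym.
have wy : w != y by rewrite eq_sym.
have wz : w != z by rewrite eq_sym.
have eq_e (a b c d : V) :
    (forall u, [|| u == x, u == y, u == z | u == w]
             = [|| u == a, u == b, u == c | u == d]) ->
    e = [set a; b; c; d].
  by move=> eq_u; rewrite def_e; apply/setP=> u; rewrite !inE -!orbA.
have tac := (xy, xz, xw, yz, yw, zw, yx, zx, wx, zy, wy, wz).
case/orP=> [G|/orP[G|/orP[G|/orP[G|/orP[G|/orP[G|G]]]]]].
- by apply: (perm x y z w); rewrite ?tac.
- apply: (perm x z y w); rewrite ?tac ?[rich3 x z y]r3R //; apply: eq_e => u.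
  by do 4!case: (u == _).
- apply: (perm x w y z); rewrite ?tac ?[rich3 x w _]r3R //; apply: eq_e => u.
  by do 4!case: (u == _).
- apply: (perm y z x w); rewrite ?tac ?[rich3 y z x]r3R ?[rich3 y x _]r3C
    ?[rich2 y x]r2C //; apply: eq_e => u.
  by do 4!case: (u == _).
- apply: (perm y w x z); rewrite ?tac ?[rich3 y w _]r3R ?[rich3 y x _]r3C
    ?[rich2 y x]r2C //; apply: eq_e => u.
  by do 4!case: (u == _).
- apply: (perm z w x y); rewrite ?tac ?[rich3 z w _]r3R ?[rich3 z x _]r3C
    ?[rich3 z y _]r3C ?[rich2 z x]r2C ?[rich2 z y]r2C //; apply: eq_e => u.
  by do 4!case: (u == _).
apply: (perm w z x y); rewrite ?tac ?[rich3 w z _]r3C ?[rich3 z w _]r3R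
  ?[rich3 z x _]r3C ?[rich3 z y _]r3C ?[rich2 w _]r2C //; apply: eq_e => u.
by do 4!case: (u == _).
Qed.

(** The factor [27 * k] comes from fewer than [9 * k] petals of at most three vertices each. *)
Lemma card_edges_le : #|H| <= 3 * (#|V| ^ 2 * (27 * k) ^ 2) + #|V| * (27 * k) ^ 3.
Proof.
apply: leq_trans (subset_leq_card edges_sub_quads) _.
apply: leq_trans (leq_imset_card _ _) _; apply: card_quads => C C_gt0.
by rewrite (leq_trans (card_small_petals H4 _ C_gt0)) // mulnA.
Qed.

End UpperBound.
Lemma ex_Sf1_Sf2_le (t n k : nat) : (t == 1) || (t == 2) -> k <= n ->
  ex 4 n (Sf 4 t k) <= 21870 * (k ^ 2 * n ^ 2).
Proof.
move=> t12 le_kn; apply/bigmax_leqP=> H /andP[H4 free].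
have t_lt4 : t < 4 by case/orP: t12 => /eqP->.
have nu_lt (C : {set 'I_n}) : #|C| = t -> sunflower_number H C < k.
  by move=> cardC; apply: sunflower_number_lt free.
have light_vertex x y : x != y -> 3 * k <= sunflower_number H [set x; y] ->
    sunflower_number H [set x] < k.
  case/orP: t12 => /eqP def_t xy rich.
    by apply: nu_lt; rewrite cards1 def_t.
  suff: k < k by rewrite ltnn.
  apply: leq_ltn_trans (nu_lt [set x; y] _); last by rewrite cards2 xy def_t.
  by apply: leq_trans rich; rewrite leq_pmull.
apply: leq_trans (card_edges_le H4 light_vertex) _; rewrite card_ord.
(* The constant is [3 * 27 ^ 2 + 27 ^ 3]; [k <= n] absorbs the star term [n * k ^ 3]. *)
have -> : 21870 * (k ^ 2 * n ^ 2) =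
    3 * (n ^ 2 * (27 * k) ^ 2) + 19683 * (n * k ^ 2) * n by ring.
have -> : n * (27 * k) ^ 3 = 19683 * (n * k ^ 2) * k by ring.
by rewrite leq_add2l leq_mul2l le_kn orbT.
Qed.

(** No triple is rich, so three vertices of an edge leave at most [27 * k] choices for the
    fourth. *)
Lemma ex_Sf3_le n k : ex 4 n (Sf 4 3 k) <= 27 * (k * n ^ 3).
Proof.
apply/bigmax_leqP=> H /andP[H4 free].
pose F (p : 'I_n * 'I_n * 'I_n) :=
  small_petals H (9 * k) [set p.1.1; p.1.2; p.2].
have leF p : #|F p| <= 27 * k.
  apply: leq_trans (card_small_petals H4 _ _) _; last by rewrite mulnA.
  by apply/card_gt0P; exists p.1.1; rewrite !inE eqxx.
have -> : 27 * (k * n ^ 3) = #|[set: 'I_n * 'I_n * 'I_n]| * (27 * k).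
  by rewrite cardsT !card_prod card_ord; ring.
apply: leq_trans (card_extend _ leF).
apply: leq_trans (leq_imset_card (@quad_set _) _).
apply/subset_leq_card/subsetP=> e eH.
have [x [y [z [w [def_e]]]]] := card4P (edge_card H4 eH).
case/and5P=> xy xz _ yz _; apply/imsetP; exists (x, y, z, w) => //.
rewrite in_extend in_setT; apply: light_triple => //; first by rewrite -def_e.
have : sunflower_number H [set x; y; z] < k.
  apply: sunflower_number_lt free => //.
  by rewrite setUC cardsU1 cards2 xy !inE negb_or ![z == _]eq_sym xz yz.
by rewrite -ltnNge => /leq_trans; apply; rewrite leq_pmull.
Qed.

(** * Lower bounds from 4-partite constructions *)

Lemma window_card k w (f : 'I_k -> nat) : injective f ->
  (forall a b, f a < f b + w) -> k <= w.
Proof.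
case: k f => // k f f_inj window.
(* All values lie in the window of length [w] that starts at the least one. *)
have [a0 _ min_a0] := @arg_minnP _ ord0 predT f isT.
have lt_w a : f a - f a0 < w.
  by rewrite ltn_subLR ?min_a0.
pose h a := Ordinal (lt_w a).
have h_inj : injective h.
  move=> a b /(congr1 val) /= eq_h; apply: f_inj.
  by rewrite -(subnK (min_a0 a isT)) eq_h subnK ?min_a0.
by have := leq_card h h_inj; rewrite !card_ord.
Qed.

(* [I] is the set of colours of the kernel, colour [i] consisting of the
   vertices [4 * x + i]; the edges have one vertex of each colour. *)
Lemma code_card_le_ex (P : finType) (n M t k w : nat) (g : P -> nat -> nat) :
  t < 4 -> 4 * M <= n -> w < k ->
  (forall p i, i < 4 -> g p i < M) ->
  (forall p q, (forall i, i < 4 -> g p i = g q i) -> p = q) ->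
  (forall I : pred nat, I 0 + I 1 + I 2 + I 3 = t ->
     exists j, [/\ j < 4, ~~ I j
       & forall p q, (forall i, i < 4 -> I i -> g p i = g q i) ->
         g p j < g q j + w]) ->
  #|P| <= ex 4 n (Sf 4 t k).
Proof.
move=> t_lt4 le_Mn lt_wk g_lt g_inj cover.
have v_lt p (i : 'I_4) : 4 * g p i + i < n.
  by have := g_lt p i (ltn_ord i); have := ltn_ord i; lia.
pose v p i : 'I_n := Ordinal (v_lt p i).
have v_eq p q i j : v p i = v q j -> i = j /\ g p i = g q j.
  move=> /(congr1 val) /= eq_v; have := ltn_ord i; have := ltn_ord j.
  move=> lt_j lt_i; have eq_ij : i = j by apply: val_inj => /=; lia.
  by split=> //; rewrite eq_ij in eq_v *; lia.
pose E p : {set 'I_n} := [set v p i | i : 'I_4].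
have in_E p q i : v p i \in E q -> g p i = g q i.
  by case/imsetP=> j _ /v_eq[<-].
have E_inj : injective E.
  move=> p q eq_E; apply: g_inj => i lt_i.
  by apply: (in_E p q (Ordinal lt_i)); rewrite -eq_E imset_f.
have card_E p : #|E p| = 4.
  by rewrite card_imset ?card_ord // => i j /v_eq[].
pose H := E @: [set: P]; have H4 : uniform 4 H.
  by apply/forall_inP=> _ /imsetP[p _ ->]; rewrite card_E.
rewrite -cardsT -(card_imset _ E_inj) -/H.
apply: (@leq_bigmax_cond _ _ (fun H : {set {set 'I_n}} => #|H|)).
rewrite H4 /=.
apply/negP=> /(contains_SfP _ t_lt4 H4)[A [C [[A_inj CA disA] cardC AH]]].
have /fin_all_exists[p pP] : forall i, exists p, A i = E p.
  by move=> i; case/imsetP: (AH i) => p _ ->; exists p.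
have k_gt0 : 0 < k by apply: leq_ltn_trans lt_wk.
pose p0 := p (Ordinal k_gt0).
pose I (c : nat) := v p0 (inord c) \in C.
have CE i : C \subset E (p i) by rewrite -pP.
have sumI : I 0 + I 1 + I 2 + I 3 = t.
  rewrite -cardC; have -> : C = [set v p0 c | c : 'I_4 & I c].
    apply/setP=> u; apply/idP/imsetP=> [uC|[c]]; last first.
      by rewrite inE /I inord_val => ? ->.
    have /imsetP[c _ def_u] := subsetP (CE (Ordinal k_gt0)) u uC.
    by exists c; rewrite // inE /I inord_val -/p0 -def_u.
  rewrite card_imset => [|i j /v_eq[]//].
  rewrite -sum1_card big_mkcond /=.
  under eq_bigr => c _ do rewrite inE.
  by rewrite !big_ord_recr big_ord0 /=; do 4!case: (I _).
have [j [lt_j4 jI window]] := cover I sumI.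
have agree0 i c : c < 4 -> I c -> g p0 c = g (p i) c.
  move=> lt_c4 cI; have := in_E p0 (p i) (inord c) (subsetP (CE i) _ cI).
  by rewrite inordK.
have agree i i' c : c < 4 -> I c -> g (p i) c = g (p i') c.
  by move=> lt_c4 cI; rewrite -!agree0.
have vj_notin i : v (p i) (inord j) \notin C.
  apply: contra jI => vC; rewrite /I.
  have /imsetP[c _ eq_v] := subsetP (CE (Ordinal k_gt0)) _ vC.
  by have [eq_c _] := v_eq _ _ _ _ eq_v; rewrite eq_c /p0 -eq_v.
(* Disjoint petals give the [k] edges distinct values in colour [j], yet [cover] confines these to a
   window of length [w < k]. *)
suff: k <= w by rewrite leqNgt lt_wk.
apply: (@window_card _ _ (fun i => g (p i) j)) => [i i' /= eq_g|i i'].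
  apply/eqP/negPn/negP=> /disA; rewrite -setI_eq0 => /eqP/setP/(_ (v (p i) (inord j))).
  have eq_v : v (p i) (inord j) = v (p i') (inord j).
    by apply: val_inj; rewrite /= inordK // eq_g.
  by rewrite !inE vj_notin /= !pP imset_f //= eq_v imset_f.
by apply: window => c; apply: agree.
Qed.

(** [M] bounds all coordinates, [N] the free ones and [s] the offsets. The largest coordinate,
    [a + 2 * b + j], is at most [4 * (N - 1) < M], and [2 * s <= k] keeps windows shorter than [k].
    Losing a factor 28 on each of four ranges yields [28 ^ 4]. *)
Lemma code_parameters n k : 4 <= n -> 2 <= k <= n ->
  exists M N s, [/\ 4 * M <= n, 4 * N <= M + 3, 0 < s <= N, 2 * s <= k
                  & n <= 28 * N /\ k <= 28 * s].
Proof.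
move=> n_ge4 k_bounds; exists (n %/ 4), ((n %/ 4 + 3) %/ 4).
by exists (minn (k %/ 2) ((n %/ 4 + 3) %/ 4)); split; lia.
Qed.

Lemma ex_Sf1_ge n k : 4 <= n -> 2 <= k <= n ->
  k ^ 2 * n ^ 2 <= 28 ^ 4 * ex 4 n (Sf 4 1 k).
Proof.
move=> n_ge4 /(code_parameters n_ge4)[M [N [s [le_M le_N s_N le_s [nN ks]]]]].
have : #|{: 'I_s * 'I_s * 'I_N * 'I_N}| <= ex 4 n (Sf 4 1 k).
  apply: (@code_card_le_ex ('I_s * 'I_s * 'I_N * 'I_N)%type n M 1 k s
    (fun p => nth 0 [:: p.1.1.1 : nat; p.1.1.2 : nat; p.1.2 : nat; p.2 : nat])).
  - by [].
  - by [].
  - by lia.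
  - move=> [[[a b] c] d] i lt_i; have := (ltn_ord a, ltn_ord b, ltn_ord c, ltn_ord d).
    by case=> [[[? ?] ?] ?]; case: i lt_i => [|[|[|[|]]]] //= _; lia.
  - move=> [[[a b] c] d] [[[a' b'] c'] d'] eq_g.
    have := (eq_g 0 isT, eq_g 1 isT, eq_g 2 isT, eq_g 3 isT).
    by case=> [[[/= /val_inj-> /val_inj->] /val_inj->] /val_inj->].
  (* A kernel of one colour misses colour 0 or colour 1, and each of these takes at most [s]
     values. *)
  move=> I sumI; exists (nat_of_bool (I 0)).
  have [I0|I0] := boolP (I 0); split=> //.
  + by move: sumI; rewrite I0; case: (I 1).
  + move=> [[[a b] c] d] [[[a' b'] c'] d'] _ /=.
    by rewrite (leq_trans (ltn_ord b)) ?leq_addl.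
  move=> [[[a b] c] d] [[[a' b'] c'] d'] _ /=.
  by rewrite (leq_trans (ltn_ord a)) ?leq_addl.
rewrite !card_prod !card_ord => le_ex.
apply: leq_trans (leq_mul (leqnn _) le_ex).
have -> : 28 ^ 4 * (s * s * N * N) = (28 * s) ^ 2 * (28 * N) ^ 2 by ring.
by rewrite leq_mul ?leq_exp2r.
Qed.

(** The widest window arises when colours 2 and 3 are fixed: this determines [b] up to a difference
    of two offsets, hence the width [2 * s - 1]. *)
Lemma ex_Sf2_ge n k : 4 <= n -> 2 <= k <= n ->
  k ^ 2 * n ^ 2 <= 28 ^ 4 * ex 4 n (Sf 4 2 k).
Proof.
move=> n_ge4 /(code_parameters n_ge4)[M [N [s [le_M le_N s_N le_s [nN ks]]]]].
have : #|{: 'I_N * 'I_N * 'I_s * 'I_s}| <= ex 4 n (Sf 4 2 k).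
  pose g (p : 'I_N * 'I_N * 'I_s * 'I_s) := let: (a, b, c, d) := p in
    nth 0 [:: a : nat; b : nat; a + b + c; a + 2 * b + d].
  apply: (@code_card_le_ex ('I_N * 'I_N * 'I_s * 'I_s)%type n M 2 k (2 * s).-1 g).
  - by [].
  - by [].
  - by lia.
  - move=> [[[a b] c] d] i lt_i; have := (ltn_ord a, ltn_ord b, ltn_ord c, ltn_ord d).
    by case=> [[[? ?] ?] ?]; case: i lt_i => [|[|[|[|]]]] //= _; lia.
  - move=> [[[a b] c] d] [[[a' b'] c'] d'] eq_g.
    have := (eq_g 0 isT, eq_g 1 isT, eq_g 2 isT, eq_g 3 isT).
    case=> [[[/= /val_inj-> /val_inj->] /addnI/val_inj->] /addnI/val_inj->] //.
  move=> I sumI.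
  have choose j u v : j < 4 -> u < 4 -> v < 4 -> I j = false -> I u -> I v ->
      (forall p q, g p u = g q u -> g p v = g q v -> g p j < g q j + (2 * s).-1) ->
      exists j, [/\ j < 4, ~~ I j & forall p q,
        (forall i, i < 4 -> I i -> g p i = g q i) -> g p j < g q j + (2 * s).-1].
    move=> lt_j lt_u lt_v Ij Iu Iv window; exists j; rewrite Ij; split=> // p q agree.
    by apply: window; apply: agree.
  move: sumI; case I0: (I 0); case I1: (I 1); case I2: (I 2); case I3: (I 3) => // _.
  - apply: (choose 2 0 1) => // -[[[a b] c] d] [[[a' b'] c'] d'] /=.
    by have := (ltn_ord c, ltn_ord c') => -[]; lia.
  - apply: (choose 1 0 2) => // -[[[a b] c] d] [[[a' b'] c'] d'] /=.
    by have := (ltn_ord c, ltn_ord c') => -[]; lia.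
  - apply: (choose 1 0 3) => // -[[[a b] c] d] [[[a' b'] c'] d'] /=.
    by have := (ltn_ord d, ltn_ord d') => -[]; lia.
  - apply: (choose 0 1 2) => // -[[[a b] c] d] [[[a' b'] c'] d'] /=.
    by have := (ltn_ord c, ltn_ord c') => -[]; lia.
  - apply: (choose 0 1 3) => // -[[[a b] c] d] [[[a' b'] c'] d'] /=.
    by have := (ltn_ord d, ltn_ord d') => -[]; lia.
  apply: (choose 1 2 3) => // -[[[a b] c] d] [[[a' b'] c'] d'] /=.
  have := (ltn_ord c, ltn_ord d, ltn_ord c', ltn_ord d').
  by case=> [[[]]]; lia.
rewrite !card_prod !card_ord => le_ex.
apply: leq_trans (leq_mul (leqnn _) le_ex).
have -> : 28 ^ 4 * (N * N * s * s) = (28 * s) ^ 2 * (28 * N) ^ 2 by ring.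
by rewrite leq_mul ?leq_exp2r.
Qed.

(** The last coordinate minus the sum of the others is an offset below [s], so any three coordinates
    confine the fourth to [s] values. *)
Lemma ex_Sf3_ge n k : 4 <= n -> 2 <= k <= n ->
  k * n ^ 3 <= 28 ^ 4 * ex 4 n (Sf 4 3 k).
Proof.
move=> n_ge4 /(code_parameters n_ge4)[M [N [s [le_M le_N s_N le_s [nN ks]]]]].
have : #|{: 'I_N * 'I_N * 'I_N * 'I_s}| <= ex 4 n (Sf 4 3 k).
  apply: (@code_card_le_ex ('I_N * 'I_N * 'I_N * 'I_s)%type n M 3 k s
    (fun p => let: (a, b, c, d) := p in
       nth 0 [:: a : nat; b : nat; c : nat; a + b + c + d])).
  - by [].
  - by [].
  - by lia.
  - move=> [[[a b] c] d] i lt_i; have := (ltn_ord a, ltn_ord b, ltn_ord c, ltn_ord d).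
    by case=> [[[? ?] ?] ?]; case: i lt_i => [|[|[|[|]]]] //= _; lia.
  - move=> [[[a b] c] d] [[[a' b'] c'] d'] eq_g.
    have := (eq_g 0 isT, eq_g 1 isT, eq_g 2 isT, eq_g 3 isT).
    by case=> [[[/= /val_inj-> /val_inj->] /val_inj->] /addnI/val_inj->].
  move=> I sumI.
  have [j [lt_j4 jI jP]] : exists j, [/\ j < 4, ~~ I j &
      forall i, i < 4 -> i != j -> I i].
    move: sumI; case I0: (I 0); case I1: (I 1); case I2: (I 2); case I3: (I 3) => // _;
      [exists 3|exists 2|exists 1|exists 0]; rewrite ?I0 ?I1 ?I2 ?I3; split=> //;
      by case=> [|[|[|[|]]]].
  exists j; split=> // -[[[a b] c] d] [[[a' b'] c'] d'] agree.
  have := (ltn_ord d, ltn_ord d') => -[? ?].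
  have {}agree i lt_i ne_ij := agree i lt_i (jP i lt_i ne_ij).
  move: agree; clear jP jI sumI; case: j lt_j4 => [|[|[|[|]]]] // _ agree /=.
  - by have /= := (agree 1 isT isT, agree 2 isT isT, agree 3 isT isT) => -[[]]; lia.
  - by have /= := (agree 0 isT isT, agree 2 isT isT, agree 3 isT isT) => -[[]]; lia.
  - by have /= := (agree 0 isT isT, agree 1 isT isT, agree 3 isT isT) => -[[]]; lia.
  by have /= := (agree 0 isT isT, agree 1 isT isT, agree 2 isT isT) => -[[]]; lia.
rewrite !card_prod !card_ord => le_ex.
apply: leq_trans (leq_mul (leqnn _) le_ex).
have -> : 28 ^ 4 * (N * N * N * s) = 28 * s * (28 * N) ^ 3 by ring.
by rewrite leq_mul ?leq_exp2r.
Qed.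

(** * From integer bounds to real constants *)

Lemma approx_on_nat (R : realType) (P : nat -> nat -> bool)
    (f g : nat -> nat -> nat) (c C : nat) : 0 < c -> 0 < C ->
  (forall n k, P n k -> g n k <= c * f n k /\ f n k <= C * g n k) ->
  approx_on R P f g.
Proof.
move=> c_gt0 C_gt0 bounds; exists (c%:R^-1)%R, (C%:R)%R.
split=> [||n k /bounds[le_g le_f]]; rewrite ?invr_gt0 ?ltr0n //.
by rewrite ler_pdivrMl ?ltr0n // -!natrM !ler_nat.
Qed.

(* For n < 4 there are no 4-element sets of vertices, so all three Turán
   numbers are 0 and the lower bounds fail for any c > 0; hence 4 <= n. *)
Theorem theorem1p2 (R : realType) :
  [/\ approx_on R (fun n k => [&& 4 <= n, 2 <= k & k <= n])
        (fun n k => ex 4 n (Sf 4 1 k)) (fun n k => k ^ 2 * n ^ 2),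
      approx_on R (fun n k => [&& 4 <= n, 2 <= k & k <= n])
        (fun n k => ex 4 n (Sf 4 2 k)) (fun n k => k ^ 2 * n ^ 2)
    & approx_on R (fun n k => [&& 4 <= n, 2 <= k & k <= n])
        (fun n k => ex 4 n (Sf 4 3 k)) (fun n k => k * n ^ 3)].
Proof.
split.
- apply: (@approx_on_nat _ _ _ _ (28 ^ 4) 21870) => // n k /and3P[n4 k2 kn].
  by split; [apply: ex_Sf1_ge; rewrite ?k2 | apply: ex_Sf1_Sf2_le].
- apply: (@approx_on_nat _ _ _ _ (28 ^ 4) 21870) => // n k /and3P[n4 k2 kn].
  by split; [apply: ex_Sf2_ge; rewrite ?k2 | apply: ex_Sf1_Sf2_le].
apply: (@approx_on_nat _ _ _ _ (28 ^ 4) 27) => // n k /and3P[n4 k2 kn].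
by split; [apply: ex_Sf3_ge; rewrite ?k2 | apply: ex_Sf3_le].
Qed.
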